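(* Let $p$ be a prime, $\Omega$ the completion of an algebraic closure of $\mathbb{Q}_p$, $\mathcal{O}$ its ring of integers, $\mathcal{Z}$ a subring of $\mathcal{O}$, and $\mathcal{A}$ a commutative unital $\mathcal{Z}$-algebra in which $2$ is a regular element (i.e. $2b=0\Rightarrow b=0$). Let $\mathcal{S}$ be the set of regular elements of $\mathcal{A}$, and identify $\mathcal{A}$ with a subalgebra of $\mathcal{S}^{-1}\mathcal{A}$. Let $(\mathbf{A}_r)_{r\ge0}$ be maps $\mathbb{N}\to\mathcal{S}$ and $(\mathbf{g}_r)_{r\ge0}$ maps $\mathbb{N}\to\mathcal{Z}\setminus\{0\}$. For a sequence $\mathcal{N}=(\mathcal{N}_r)_{r\ge0}$ of subsets of $\bigcup_{t\ge1}(\{0,\dots,p^t-1\}\times\{t\})$ and for $r\ge-1$, $s\ge0$, let $\Psi_{\mathcal{N}}(r,s)$ be the set of $u\in\{0,\dots,p^s-1\}$ such that for all $(n,t)\in\mathcal{N}_{r+s-t+1}$ with $t\le s$ and all $j\in\{0,\dots,p^{s-t}-1\}$ we have $u\ne j+p^{s-t}n$ (so $\Psi_{\mathcal{N}}(r,0)=\{0\}$). Assume there is such a sequence $\mathcal{N}$ such that for all $r\ge0$: (i) $\mathbf{A}_r(0)$ is invertible in $\mathcal{A}$; (ii) for all $m\in\mathbb{N}$, $\mathbf{A}_r(m)\in\mathbf{g}_r(m)\mathcal{A}$; (iii) for all $s,m\in\mathbb{N}$: (a) for all $u\in\Psi_{\mathcal{N}}(r,s)$ and $v\in\{0,\dots,p-1\}$,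 $\frac{\mathbf{A}_r(v+up+mp^{s+1})}{\mathbf{A}_r(v+up)}-\frac{\mathbf{A}_{r+1}(u+mp^s)}{\mathbf{A}_{r+1}(u)}\in p^{s+1}\frac{\mathbf{g}_{r+s+1}(m)}{\mathbf{A}_r(v+up)}\mathcal{A}$; ($a_1$) moreover if $v+up\in\Psi_{\mathcal{N}}(r-1,s+1)$, then $\mathbf{g}_r(v+up)\Big(\frac{\mathbf{A}_r(v+up+mp^{s+1})}{\mathbf{A}_r(v+up)}-\frac{\mathbf{A}_{r+1}(u+mp^s)}{\mathbf{A}_{r+1}(u)}\Big)\in p^{s+1}\mathbf{g}_{r+s+1}(m)\mathcal{A}$; ($a_2$) if $v+up\notin\Psi_{\mathcal{N}}(r-1,s+1)$, then $\mathbf{g}_r(v+up)\frac{\mathbf{A}_{r+1}(u+mp^s)}{\mathbf{A}_{r+1}(u)}\in p^{s+1}\mathbf{g}_{r+s+1}(m)\mathcal{A}$; (b) for all $(n,t)\in\mathcal{N}_r$, $\mathbf{g}_r(n+mp^t)\in p^t\mathbf{g}_{r+t}(m)\mathcal{Z}$. Then for all $a\in\{0,\dots,p-1\}$ and all $m,s,r,K\in\mathbb{N}$, $$ \sum_{j=mp^s}^{(m+1)p^s-1}\Big(\mathbf{A}_r\big(a+(K-j)p\big)\mathbf{A}_{r+1}(j)-\mathbf{A}_{r+1}(K-j)\mathbf{A}_r(a+jp)\Big)\in p^{s+1}\mathbf{g}_{r+s+1}(m)\mathcal{A}, $$ where $\mathbf{A}_r(n)=0$ for $n<0$.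
   Context: Generalization of Dwork's formal congruences theorem; all objects are defined in the claim. *)

(* Defs.v *)
From HB Require Import structures.
From mathcomp Require Import all_boot all_order all_algebra.
From mathcomp Require Import ring.
From mathcomp Require Import boolp classical_sets reals.

Set Implicit Arguments.
Unset Strict Implicit.
Unset Printing Implicit Defensive.

Import Order.TTheory GRing.Theory Num.Theory.

Local Open Scope classical_set_scope.
Local Open Scope ring_scope.
Local Open Scope quotient_scope.

Section ValuedFields.
Variable R : realType.

Definition is_nonarch_abs (K : fieldType) (abs : K -> R) : Prop :=
  [/\ forall x, 0 <= abs x,
      forall x, abs x = 0 <-> x = 0,
      forall x y, abs (x * y) = abs x * abs y &
      forall x y, abs (x + y) <= Num.max (abs x) (abs y)].

Definition is_complete (K : fieldType) (abs : K -> R) : Prop :=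
  forall u : nat -> K,
    (forall e : R, 0 < e -> exists n0, forall m n, (n0 <= m)%N -> (n0 <= n)%N ->
       abs (u m - u n) < e) ->
    exists l : K, forall e : R, 0 < e -> exists n0, forall n, (n0 <= n)%N ->
       abs (u n - l) < e.

Definition is_completion (K L : fieldType) (absK : K -> R) (absL : L -> R)
    (f : {rmorphism K -> L}) : Prop :=
  [/\ is_nonarch_abs absL,
      forall x, absL (f x) = absK x,
      forall (y : L) (e : R), 0 < e -> exists x : K, absL (y - f x) < e &
      is_complete absL].

Definition is_algebraic_closure (K L : fieldType) (f : {rmorphism K -> L}) :
    Prop :=
  GRing.closed_field_axiom L /\ forall y : L, algebraicOver f y.

(* |q| = p ^ - v_p(q), normalised by |p| = 1/p. *)
Definition padic_abs (p : nat) (q : rat) : R :=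
  if q == 0 then 0
  else p%:R ^+ logn p `|denq q|%N / p%:R ^+ logn p `|numq q|%N.

(* Tower QQ -> Q_p -> algebraic closure of Q_p -> Omega.  The absolute value on
   the algebraic closure is the (unique) one extending that of Q_p. *)
Definition is_completed_alg_closure_Qp (p : nat) (Omega : fieldType)
    (abs : Omega -> R) : Prop :=
  exists (Qp : fieldType) (absQp : Qp -> R) (i : {rmorphism rat -> Qp})
         (Qpbar : fieldType) (absQpbar : Qpbar -> R)
         (j : {rmorphism Qp -> Qpbar}) (k : {rmorphism Qpbar -> Omega}),
    [/\ is_completion (padic_abs p) absQp i,
        is_algebraic_closure j,
        is_nonarch_abs absQpbar /\ (forall x, absQpbar (j x) = absQp x) &
        is_completion absQpbar abs k].

End ValuedFields.

(* Rings may be trivial here (comPzRingType), hence the total ring of fractions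
   is not a unitRingType and fractions are written [tfrac a s]. *)
Section TotalFractions.
Variable A : comPzRingType.

Definition regb : {pred A} := fun s => `[< GRing.lreg s >].

Record regular := Regular { reg_val :> A; reg_valP : reg_val \in regb }.

HB.instance Definition _ := [isSub for reg_val].
HB.instance Definition _ := [Choice of regular by <:].

Lemma regP (s : regular) : GRing.lreg (val s).
Proof. by case: s => s /= /asboolP. Qed.

Lemma reg1_subproof : (1 : A) \in regb.
Proof. by apply/asboolP; exact: GRing.lreg1. Qed.
Definition reg1 := Regular reg1_subproof.

Lemma regM_subproof (s t : regular) : val s * val t \in regb.
Proof. by apply/asboolP; apply: GRing.lregM; exact: regP. Qed.
Definition regM s t := Regular (regM_subproof s t).

Definition freq (x y : A * regular) := x.1 * val y.2 == y.1 * val x.2.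

Lemma freq_refl : reflexive freq. Proof. by move=> x; exact: eqxx. Qed.
Lemma freq_sym : symmetric freq.
Proof. by move=> x y; rewrite /freq eq_sym. Qed.
Lemma freq_trans : transitive freq.
Proof.
move=> y x z; rewrite /freq => /eqP xy /eqP yz; apply/eqP.
apply: (@regP y.2); ring: xy yz.
Qed.
Canonical freq_equiv := EquivRel freq freq_refl freq_sym freq_trans.

Definition totfrac := {eq_quot freq}.
HB.instance Definition _ : EqQuotient _ freq totfrac := EqQuotient.on totfrac.
HB.instance Definition _ := Choice.on totfrac.

Definition tfrac (a : A) (s : regular) : totfrac := \pi_totfrac (a, s).

Lemma tfrac_eqP a s b t : tfrac a s = tfrac b t <-> a * val t = b * val s.
Proof.
by split=> [/eqmodP /eqP | e] //; apply/eqmodP/eqP.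
Qed.

Lemma tfracW (P : totfrac -> Prop) : (forall a s, P (tfrac a s)) -> forall x, P x.
Proof. by move=> H; elim/quotW => -[a s]; exact: H. Qed.

Definition tf_add (x y : totfrac) : totfrac :=
  let: (a, s) := repr x in let: (b, t) := repr y in
  tfrac (a * val t + b * val s) (regM s t).
Definition tf_opp (x : totfrac) : totfrac :=
  let: (a, s) := repr x in tfrac (- a) s.
Definition tf_mul (x y : totfrac) : totfrac :=
  let: (a, s) := repr x in let: (b, t) := repr y in tfrac (a * b) (regM s t).

Lemma repr_tfrac a s : let: (b, t) := repr (tfrac a s) in b * val s = a * val t.
Proof.
case E: (repr _) => [b t]; apply/tfrac_eqP.
by rewrite /tfrac -E reprK.
Qed.

Lemma tfracD a s b t :
  tf_add (tfrac a s) (tfrac b t) = tfrac (a * val t + b * val s) (regM s t).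
Proof.
rewrite /tf_add; have := repr_tfrac a s; have := repr_tfrac b t.
case: (repr (tfrac a s)) => a' s'; case: (repr (tfrac b t)) => b' t' /= eb ea.
by apply/tfrac_eqP => /=; ring: ea eb.
Qed.

Lemma tfracN a s : tf_opp (tfrac a s) = tfrac (- a) s.
Proof.
rewrite /tf_opp; have := repr_tfrac a s; case: (repr _) => a' s' /= ea.
by apply/tfrac_eqP => /=; ring: ea.
Qed.

Lemma tfracM a s b t : tf_mul (tfrac a s) (tfrac b t) = tfrac (a * b) (regM s t).
Proof.
rewrite /tf_mul; have := repr_tfrac a s; have := repr_tfrac b t.
case: (repr (tfrac a s)) => a' s'; case: (repr (tfrac b t)) => b' t' /= eb ea.
by apply/tfrac_eqP => /=; ring: ea eb.
Qed.

Fact tf_addA : associative tf_add.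
Proof.
elim/tfracW=> a s; elim/tfracW=> b t; elim/tfracW=> c w.
by rewrite ?(tfracD, tfracM); apply/tfrac_eqP => /=; ring.
Qed.
Fact tf_addC : commutative tf_add.
Proof.
elim/tfracW=> a s; elim/tfracW=> b t.
by rewrite ?(tfracD, tfracM); apply/tfrac_eqP => /=; ring.
Qed.
Fact tf_add0 : left_id (tfrac 0 reg1) tf_add.
Proof.
elim/tfracW=> a s.
by rewrite ?(tfracN, tfracD, tfracM); apply/tfrac_eqP => /=; ring.
Qed.
Fact tf_addN : left_inverse (tfrac 0 reg1) tf_opp tf_add.
Proof.
elim/tfracW=> a s.
by rewrite ?(tfracN, tfracD, tfracM); apply/tfrac_eqP => /=; ring.
Qed.
HB.instance Definition _ :=
  GRing.isZmodule.Build totfrac tf_addA tf_addC tf_add0 tf_addN.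

Fact tf_mulA : associative tf_mul.
Proof.
elim/tfracW=> a s; elim/tfracW=> b t; elim/tfracW=> c w.
by rewrite ?(tfracD, tfracM); apply/tfrac_eqP => /=; ring.
Qed.
Fact tf_mulC : commutative tf_mul.
Proof.
elim/tfracW=> a s; elim/tfracW=> b t.
by rewrite ?(tfracD, tfracM); apply/tfrac_eqP => /=; ring.
Qed.
Fact tf_mul1 : left_id (tfrac 1 reg1) tf_mul.
Proof.
elim/tfracW=> a s.
by rewrite ?(tfracN, tfracD, tfracM); apply/tfrac_eqP => /=; ring.
Qed.
Fact tf_mulDl : left_distributive tf_mul tf_add.
Proof.
elim/tfracW=> a s; elim/tfracW=> b t; elim/tfracW=> c w.
by rewrite ?(tfracD, tfracM); apply/tfrac_eqP => /=; ring.
Qed.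
HB.instance Definition _ :=
  GRing.Zmodule_isComPzRing.Build totfrac tf_mulA tf_mulC tf_mul1 tf_mulDl.

Definition to_tfrac (a : A) : totfrac := tfrac a reg1.

Fact to_tfrac_is_zmod_morphism : zmod_morphism to_tfrac.
Proof.
move=> a b; rewrite /to_tfrac -[RHS]/(tf_add _ (tf_opp _)) tfracN tfracD.
by apply/tfrac_eqP => /=; ring.
Qed.
Fact to_tfrac_is_monoid_morphism : monoid_morphism to_tfrac.
Proof.
split=> // a b; rewrite /to_tfrac -[RHS]/(tf_mul _ _) tfracM.
by apply/tfrac_eqP => /=; ring.
Qed.
HB.instance Definition _ :=
  GRing.isZmodMorphism.Build A totfrac to_tfrac to_tfrac_is_zmod_morphism.
HB.instance Definition _ :=
  GRing.isMonoidMorphism.Build A totfrac to_tfrac to_tfrac_is_monoid_morphism.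

Lemma to_tfrac_inj : injective to_tfrac.
Proof. by move=> a b /tfrac_eqP; rewrite /= !mulr1. Qed.

Lemma tfracE a s : tfrac a s * to_tfrac (val s) = to_tfrac a.
Proof.
rewrite -[LHS]/(tf_mul _ _) tfracM; apply/tfrac_eqP => /=.
by ring.
Qed.

End TotalFractions.

Definition mul_ideal (B : comPzRingType) (c : B) : set B :=
  range (fun b : B => c * b).

Definition tfrac_ideal (A : comPzRingType) (c : totfrac A) : set (totfrac A) :=
  range (fun b : A => c * to_tfrac b).

(* [Psi p N r1 s] is Psi_N(r1 - 1, s): the first index of Psi_N ranges over the
   integers >= -1 and is shifted by 1. *)
Definition Psi (p : nat) (N : nat -> set (nat * nat)) (r1 s : nat) : set nat :=
  [set u | (u < p ^ s)%N /\
    forall n t, (t <= s)%N -> N (r1 + (s - t))%N (n, t) ->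
      forall j, (j < p ^ (s - t))%N -> u <> (j + p ^ (s - t) * n)%N].

Definition ext_zero (B : nmodType) (f : nat -> B) (n : int) : B :=
  if n is Posz k then f k else 0.

(* Main.v *)
(* Write S(r,K,s,m) for the sum to be estimated and call u alive at level s when
   it lies in Psi.  By induction on s, the claim at all smaller levels gives
     S(r, K + m p^s, k, w + m p^l) = A_{r+k+1}(w + m p^l) / A_{r+k+1}(w) S(r,K,k,w)
   modulo p^(s+1) g_{r+s+1}(m) for k + l = s and w alive, by induction on k: the
   left side splits into p children, the alive ones are handled by (a_1), the
   dead ones by (b) and (a_2).  At k = s this reads
     S(r, K + m p^s, s, m) = A_{r+s+1}(m) / A_{r+s+1}(0) S(r,K,s,0),
   which reduces everything to m = 0.  Since the sum of S(r,K,s,m) over all m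
   vanishes by antisymmetry, S(r,K,s,0) is minus the sum of the S(r,K,s,m) with
   m > 0, which are governed by smaller values of K. *)

Require Import Defs.
From mathcomp Require Import all_boot all_order all_algebra.
From mathcomp Require Import ring zify.
From mathcomp Require Import boolp classical_sets reals.

Set Implicit Arguments.
Unset Strict Implicit.
Unset Printing Implicit Defensive.

Import Order.TTheory GRing.Theory Num.Theory.
Local Open Scope classical_set_scope.
Local Open Scope ring_scope.

(** * Index blocks and the exclusion sets *)

Lemma big_nat_block (V : nmodType) (m a b : nat) (F : nat -> V) :
  \sum_(m * (b * a) <= j < m.+1 * (b * a)) F j =
  \sum_(0 <= v < b) \sum_((v + m * b) * a <= j < (v + m * b).+1 * a) F j.
Proof.
rewrite -{1}[(m * _)%N]add0n big_addn mulSn addnK big_nat_mul.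
apply: eq_bigr => v _.
rewrite [in RHS]mulSn mulnDl -mulnA big_addn; congr bigop.
by congr (index_iota _ _); nia.
Qed.

(** A pair [(n, t)] with [t <= l] that excludes the child would, after division by [p], already
    exclude [w]. So the excluding pair has [t = l.+1], which forces [j = 0], and it is the child
    itself. *)
Lemma not_Psi_child (p : nat) (N : nat -> set (nat * nat)) (r l w v : nat) :
  Psi p N r.+1 l w -> (v < p)%N -> ~ Psi p N r l.+1 (v + w * p)%N ->
  N r (v + w * p, l.+1)%N.
Proof.
move=> [wl wN] vp; apply: contra_notP => notN; split.
  by rewrite expnSr; nia.
move=> n t tl Nnt j jp eq_vw.
have [eq_t|lt_t] : (t = l.+1 \/ t <= l)%N by lia.
  apply: notN; subst t; move: Nnt jp eq_vw; rewrite subnn addn0 expn0 mul1n.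
  by case: j => [|//] Nnt _ ->.
apply: (wN n t lt_t _ (j %/ p)%N).
- by move: Nnt; rewrite subSn // addnS addSn.
- by rewrite ltn_divLR -?expnSr -?subSn //; lia.
- have -> : w = ((v + w * p) %/ p)%N.
    by rewrite addnC divnMDl ?divn_small ?addn0 //; lia.
  rewrite eq_vw subSn // expnS -mulnA [(p * _)%N]mulnC addnC divnMDl; last lia.
  by rewrite addnC.
Qed.

Lemma Psi0 (p : nat) (N : nat -> set (nat * nat)) (r : nat) :
  (forall r n t, N r (n, t) -> (1 <= t)%N) -> Psi p N r 0 0.
Proof. by move=> N_gt0; split=> // n [|//] _ /N_gt0. Qed.

Lemma ext_zero_lt0 (V : nmodType) (f : nat -> V) (n : int) :
  n < 0 -> ext_zero f n = 0.
Proof. by case: n. Qed.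

(** * Calculus of the sets cA inside the total ring of fractions *)

Section TotalFractionIdeal.
Variable A : comPzRingType.
Implicit Types (c d x y : totfrac A) (b : A).

Lemma tfrac_ideal0 c : tfrac_ideal c 0.
Proof. by exists 0 => //; rewrite rmorph0 mulr0. Qed.

Lemma tfrac_idealD c x y :
  tfrac_ideal c x -> tfrac_ideal c y -> tfrac_ideal c (x + y).
Proof. by move=> [a _ <-] [b _ <-]; exists (a + b) => //; rewrite rmorphD mulrDr. Qed.

Lemma tfrac_idealN c x : tfrac_ideal c x -> tfrac_ideal c (- x).
Proof. by move=> [a _ <-]; exists (- a) => //; rewrite rmorphN mulrN. Qed.

Lemma tfrac_idealB c x y :
  tfrac_ideal c x -> tfrac_ideal c y -> tfrac_ideal c (x - y).
Proof. by move=> cx /tfrac_idealN; exact: tfrac_idealD. Qed.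

Lemma tfrac_ideal_sum c m n (F : nat -> totfrac A) :
  (forall i, (m <= i < n)%N -> tfrac_ideal c (F i)) ->
  tfrac_ideal c (\sum_(m <= i < n) F i).
Proof.
move=> cF; rewrite big_seq; apply: big_ind => [||i].
- exact: tfrac_ideal0.
- exact: tfrac_idealD.
- by rewrite mem_index_iota; exact: cF.
Qed.

Lemma tfrac_idealM c d x y :
  tfrac_ideal c x -> tfrac_ideal d y -> tfrac_ideal (c * d) (x * y).
Proof. by move=> [a _ <-] [b _ <-]; exists (a * b) => //; rewrite rmorphM; ring. Qed.

Lemma tfrac_ideal_gen c : tfrac_ideal c c.
Proof. by exists 1 => //; rewrite rmorph1 mulr1. Qed.

Lemma tfrac_ideal1 b : tfrac_ideal 1 (to_tfrac b).
Proof. by exists b => //; rewrite mul1r. Qed.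

Lemma tfrac_ideal_trans c d x :
  tfrac_ideal d x -> tfrac_ideal c d -> tfrac_ideal c x.
Proof. by move=> [a _ <-] [b _ <-]; exists (b * a) => //; rewrite rmorphM mulrA. Qed.

(** Rests on the injectivity of [to_tfrac]; it lets the argument run with fractions and come back to
    A at the end. *)
Lemma tfrac_ideal_mul_ideal b b' :
  tfrac_ideal (to_tfrac b) (to_tfrac b') <-> mul_ideal b b'.
Proof.
split=> [[a _]|[a _ <-]]; last by exists a => //; rewrite rmorphM.
by rewrite -rmorphM => /to_tfrac_inj eq_b'; exists a.
Qed.

End TotalFractionIdeal.

(** * Congruences for the sums, with [G] standing for the image of g in A *)

Section Congruences.
Variables (p : nat) (A : comPzRingType).
Variables (AA : nat -> nat -> regular A) (G : nat -> nat -> A).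
Variable N : nat -> set (nat * nat).
Hypothesis N_gt0 : forall r n t, N r (n, t) -> (1 <= t)%N.
Hypothesis AA0_unit : forall r, exists b : A, val (AA r 0%N) * b = 1.
Hypothesis AA_G : forall r m, mul_ideal (G r m) (val (AA r m)).

Let Q (r u m l : nat) : totfrac A :=
  tfrac (val (AA r (u + m * p ^ l)%N)) (AA r u).
Let B (r n : nat) : totfrac A := to_tfrac (val (AA r n)).
Let pG (e r m : nat) : totfrac A := p%:R ^+ e * to_tfrac (G r m).

Hypothesis cong : forall r s m u v, Psi p N r.+1 s u -> (v < p)%N ->
  tfrac_ideal (p%:R ^+ s.+1 * tfrac (G (r + s + 1)%N m) (AA r (v + u * p)%N))
    (Q r (v + u * p) m s.+1 - Q r.+1 u m s).
Hypothesis cong_in : forall r s m u v, Psi p N r.+1 s u -> (v < p)%N ->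
  Psi p N r s.+1 (v + u * p)%N ->
  tfrac_ideal (pG s.+1 (r + s + 1) m)
    (to_tfrac (G r (v + u * p)%N) * (Q r (v + u * p) m s.+1 - Q r.+1 u m s)).
Hypothesis cong_notin : forall r s m u v, Psi p N r.+1 s u -> (v < p)%N ->
  ~ Psi p N r s.+1 (v + u * p)%N ->
  tfrac_ideal (pG s.+1 (r + s + 1) m)
    (to_tfrac (G r (v + u * p)%N) * Q r.+1 u m s).
Hypothesis N_G : forall r n t m, N r (n, t) ->
  tfrac_ideal (pG t (r + t) m) (to_tfrac (G r (n + m * p ^ t)%N)).

Variable a : nat.
Hypothesis a_lt_p : (a < p)%N.

(* As a < p, both terms of the summand have a negative index when K < j. *)
Definition dwork_term (r K j : nat) : totfrac A :=
  if (j <= K)%N then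
    B r (a + (K - j) * p)%N * B r.+1 j - B r.+1 (K - j)%N * B r (a + j * p)%N
  else 0.

Definition dwork_sum (r K s m : nat) : totfrac A :=
  \sum_(m * p ^ s <= j < m.+1 * p ^ s) dwork_term r K j.

Lemma dwork_sum_expS (r K s m : nat) :
  dwork_sum r K s.+1 m = \sum_(0 <= v < p) dwork_sum r K s (v + m * p)%N.
Proof. by rewrite /dwork_sum expnS big_nat_block. Qed.

Lemma dwork_sum_exp0 (r K m : nat) : dwork_sum r K 0 m = dwork_term r K m.
Proof. by rewrite /dwork_sum expn0 !muln1 big_nat1. Qed.

Lemma dwork_sum_gt (r K s m : nat) : (K < m * p ^ s)%N -> dwork_sum r K s m = 0.
Proof.
move=> lt_K; rewrite /dwork_sum big_nat big1 // => j /andP[le_j _].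
by rewrite /dwork_term leqNgt (leq_trans lt_K le_j).
Qed.

(** Terms beyond [K] vanish, and the reflection j -> K - j exchanges the two products in the
    remaining ones. *)
Lemma dwork_sum_total (r K s M : nat) : (K < M * p ^ s)%N ->
  \sum_(0 <= m < M) dwork_sum r K s m = 0.
Proof.
move=> lt_K; rewrite -big_nat_mul (big_cat_nat _ (n := K.+1)) //=.
rewrite [X in _ + X]big_nat [X in _ + X]big1 ?addr0; last first.
  by move=> j /andP[]; rewrite /dwork_term ltnNge => /negPf->.
under eq_big_nat => j; first by rewrite ltnS /dwork_term => /andP[_ ->]; over.
rewrite sumrB [X in _ - X]big_nat_rev add0n /=; apply/eqP; rewrite subr_eq0.
apply/eqP/eq_big_nat => j /andP[_]; rewrite ltnS => jK.
by rewrite subSS subKn // mulrC.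
Qed.

Lemma Q_mulr (r u m l : nat) : Q r u m l * B r u = B r (u + m * p ^ l)%N.
Proof. exact: tfracE. Qed.

Lemma dwork_term_shift (r K l w m : nat) : Psi p N r.+1 l w ->
  tfrac_ideal (pG l.+1 (r + l + 1) m)
    (dwork_term r (K + m * p ^ l) (w + m * p ^ l)
       - Q r.+1 w m l * dwork_term r K w).
Proof.
move=> Psi_w; rewrite /dwork_term leq_add2r; case: leqP => wK; last first.
  by rewrite mulr0 subr0; exact: tfrac_ideal0.
rewrite subnDr mulnDl addnA -mulnA -expnSr.
rewrite -(Q_mulr r.+1 w m l) -(Q_mulr r (a + w * p) m l.+1).
set x := B r.+1 (K - w); set y := B r (a + w * p).
(* Once both shifted values are written through [Q], the products containing [B r.+1 w] cancel. What
   remains is [- x * y] times the difference in [cong], and [y] clears its denominator. *)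
have := tfrac_idealM (cong m Psi_w a_lt_p) (tfrac_ideal_gen y).
rewrite -mulrA tfracE -/(pG _ _ _) => /tfrac_idealM/(_ (tfrac_ideal1 _)) cxy.
have {}cxy := tfrac_idealN (cxy (val (AA r.+1 (K - w)))).
move: cxy; rewrite mulr1 -/(B _ _) -/x; congr (tfrac_ideal _ _); ring.
Qed.

(** The factor [g] is taken out of [x] and spent on [y], which may be a fraction whose product with
    [g] alone is under control. *)
Lemma pG_mulr (e e' r m : nat) (x y g : totfrac A) :
  tfrac_ideal (p%:R ^+ e * g) x -> tfrac_ideal (pG e' r m) (g * y) ->
  tfrac_ideal (pG (e + e') r m) (y * x).
Proof.
move=> [b _ <-] gy; have := tfrac_idealM gy (tfrac_ideal1 b).
move=> /(tfrac_idealM (tfrac_ideal_gen (p%:R ^+ e))).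
rewrite mulr1 /pG mulrA -exprD; congr (tfrac_ideal _ _); ring.
Qed.

Lemma dwork_sum_shift (s m : nat) :
  (forall k, (k < s)%N -> forall r K n,
     tfrac_ideal (pG k.+1 (r + k + 1) n) (dwork_sum r K k n)) ->
  forall k l r K w, (k + l)%N = s -> Psi p N (r + k).+1 l w ->
    tfrac_ideal (pG s.+1 (r + s + 1) m)
      (dwork_sum r (K + m * p ^ s) k (w + m * p ^ l)
         - Q (r + k).+1 w m l * dwork_sum r K k w).
Proof.
move=> alpha; elim=> [|k IHk] l r K w eq_s Psi_w.
  move: Psi_w; rewrite -eq_s add0n addn0 !dwork_sum_exp0.
  exact: dwork_term_shift.
rewrite !dwork_sum_expS mulr_sumr -sumrB; apply: tfrac_ideal_sum => v /andP[_ vp].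
have -> : (v + (w + m * p ^ l) * p = v + w * p + m * p ^ l.+1)%N.
  by rewrite expnSr; lia.
have alphak K' n : tfrac_ideal (pG k.+1 (r + k).+1 n) (dwork_sum r K' k n).
  by rewrite -[(r + k).+1]addn1; apply: alpha; lia.
have eq_r : (r + s + 1 = (r + k).+1 + l + 1)%N by lia.
(* The [k.+1] powers of p come from the child sum through [alpha], the other [l.+1] from the
   hypotheses on [Q] and [G]. *)
have eq_e : (s.+1 = k.+1 + l.+1)%N by lia.
rewrite addnS in Psi_w *; rewrite eq_e.
have [Psi_v|nPsi_v] := pselect (Psi p N (r + k).+1 l.+1 (v + w * p)%N).
  have := IHk l.+1 r K _ ltac:(lia) Psi_v; rewrite eq_e.
  (* Alive child: the induction hypothesis has the child's ratio as coefficient, and [cong_in] pays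
     for replacing it by the parent's ratio. *)
  have := cong_in m Psi_w vp Psi_v; rewrite -eq_r.
  move=> /(pG_mulr (alphak K _)) /tfrac_idealD h /h.
  by congr (tfrac_ideal _ _); ring.
(* Dead child: the shifted sum and the multiple of the unshifted one lie in the ideal separately. *)
apply: tfrac_idealB.
  have := N_G m (not_Psi_child Psi_w vp nPsi_v).
  rewrite -[to_tfrac _]mulr1 => /(pG_mulr (alphak (K + m * p ^ s)%N _)).
  by rewrite mul1r; congr (tfrac_ideal (pG _ _ _) _); lia.
have := cong_notin m Psi_w vp nPsi_v; rewrite -eq_r.
by move=> /(pG_mulr (alphak K _)).
Qed.

(** The denominator is a unit, so the fraction lies in A and keeps the divisibility of its numerator
    by [G r m]. *)
Lemma Q0_ideal (r m : nat) : tfrac_ideal (to_tfrac (G r m)) (Q r 0 m 0).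
Proof.
have [b AAb] := AA0_unit r.
suff -> : Q r 0 m 0 = to_tfrac (val (AA r m) * b).
  rewrite tfrac_ideal_mul_ideal; have [c _ <-] := AA_G r m.
  by exists (c * b) => //; rewrite mulrA.
apply/tfrac_eqP; rewrite /= add0n expn0 muln1; by rewrite -mulrA [b * _]mulrC AAb.
Qed.

Lemma dwork_sum_ideal (s r K m : nat) :
  tfrac_ideal (pG s.+1 (r + s + 1) m) (dwork_sum r K s m).
Proof.
elim/ltn_ind: s r K m => s alpha r K m.
have shift K' n : tfrac_ideal (pG s.+1 (r + s + 1) n)
    (dwork_sum r (K' + n * p ^ s) s n
       - Q (r + s + 1) 0 n 0 * dwork_sum r K' s 0).
  have := @dwork_sum_shift s n alpha s 0 r K' 0 (addn0 s) (Psi0 _ _ N_gt0).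
  by rewrite expn0 muln1 add0n addn1.
have Q0_mul n x : tfrac_ideal (p%:R ^+ s.+1) x ->
    tfrac_ideal (pG s.+1 (r + s + 1) n) (Q (r + s + 1) 0 n 0 * x).
  by move=> /(tfrac_idealM (Q0_ideal (r + s + 1) n)); rewrite mulrC [_ * x]mulrC.
have from0 K' n : tfrac_ideal (p%:R ^+ s.+1) (dwork_sum r (K' - n * p ^ s) s 0) ->
    tfrac_ideal (pG s.+1 (r + s + 1) n) (dwork_sum r K' s n).
  case: (ltnP K' (n * p ^ s)) => [/dwork_sum_gt-> _|le_K]; first exact: tfrac_ideal0.
  move=> /Q0_mul/(tfrac_idealD (shift (K' - n * p ^ s)%N n)).
  by rewrite subnK // subrK.
(* [Q0_ideal] supplies the factor [G], so for block 0 only divisibility by [p ^ s.+1] has to be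
   shown. *)
apply: (from0).
elim/ltn_ind: (_ - _)%N => {K m} K IHK.
have ps_gt0 : (0 < p ^ s)%N by rewrite expn_gt0; lia.
(* As blocks are nonempty, [K.+1] of them reach past [K]. *)
have := @dwork_sum_total r K s K.+1 ltac:(nia).
rewrite big_nat_recl // => /eqP; rewrite addr_eq0 => /eqP ->.
apply/tfrac_idealN/tfrac_ideal_sum => n _.
have [lt_K|le_K] := ltnP K (n.+1 * p ^ s)%N.
  by rewrite dwork_sum_gt //; exact: tfrac_ideal0.
apply: tfrac_ideal_trans (from0 _ _ (IHK _ _)) _; first by nia.
by eexists.
Qed.

End Congruences.

(** * Return from fractions to A *)

Theorem theorem4 (R : realType) (p : nat) (p_prime : prime p)
    (Omega : fieldType) (abs : Omega -> R)
    (OmegaP : is_completed_alg_closure_Qp p abs)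
    (inZ : pred Omega) (Z : subComPzRingType inZ)
    (Z_int : forall z : Z, abs (\val z) <= 1)
    (A : comPzRingType) (phi : {rmorphism Z -> A})
    (two_regular : GRing.lreg (2%:R : A))
    (AA : nat -> nat -> regular A)
    (g : nat -> nat -> Z) (g_neq0 : forall r m, g r m != 0)
    (hyps : exists N : nat -> set (nat * nat),
      (forall r n t, N r (n, t) -> (1 <= t)%N /\ (n < p ^ t)%N) /\
      forall r : nat,
      [/\ exists b : A, \val (AA r 0%N) * b = 1,
          forall m, mul_ideal (phi (g r m)) (\val (AA r m)) &
          forall s m : nat,
            (forall u v : nat, Psi p N r.+1 s u -> (v < p)%N ->
              let q1 := tfrac (\val (AA r (v + u * p + m * p ^ s.+1)%N))
                             (AA r (v + u * p)%N) in
              let q2 := tfrac (\val (AA r.+1 (u + m * p ^ s)%N)) (AA r.+1 u) in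
              let gv := to_tfrac (phi (g r (v + u * p)%N)) in
              [/\ tfrac_ideal (p%:R ^+ s.+1 *
                     tfrac (phi (g (r + s + 1)%N m)) (AA r (v + u * p)%N))
                    (q1 - q2),
                  Psi p N r s.+1 (v + u * p)%N ->
                    tfrac_ideal (p%:R ^+ s.+1 * to_tfrac (phi (g (r + s + 1)%N m)))
                      (gv * (q1 - q2)) &
                  ~ Psi p N r s.+1 (v + u * p)%N ->
                    tfrac_ideal (p%:R ^+ s.+1 * to_tfrac (phi (g (r + s + 1)%N m)))
                      (gv * q2)]) /\
            (forall n t : nat, N r (n, t) ->
               mul_ideal (p%:R ^+ t * g (r + t)%N m) (g r (n + m * p ^ t)%N))])
    (a m s r K : nat) (a_lt_p : (a < p)%N) :
  let Az (r : nat) (n : int) := ext_zero (fun k => \val (AA r k)) n in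
  mul_ideal (p%:R ^+ s.+1 * phi (g (r + s + 1)%N m))
    (\sum_((m * p ^ s)%N <= j < (m.+1 * p ^ s)%N)
       (Az r (a%:Z + (K%:Z - j%:Z) * p%:Z) * \val (AA r.+1 j) -
        Az r.+1 (K%:Z - j%:Z) * \val (AA r (a + j * p)%N))).
Proof.
move=> Az; case: hyps => N [N_range hN].
rewrite -tfrac_ideal_mul_ideal rmorphM rmorphXn rmorph_nat.
suff -> : to_tfrac (\sum_(m * p ^ s <= j < m.+1 * p ^ s)
    (Az r (a%:Z + (K%:Z - j%:Z) * p%:Z) * \val (AA r.+1 j) -
     Az r.+1 (K%:Z - j%:Z) * \val (AA r (a + j * p)%N))) =
    dwork_sum p AA a r K s m.
  apply: (@dwork_sum_ideal p A AA (fun r m => phi (g r m)) N) => //.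
  - by move=> r' n t /N_range[].
  - by move=> r'; have [] := hN r'.
  - by move=> r' n; have [] := hN r'.
  - move=> r' s' n u v Psi_u vp; have [_ _ h] := hN r'.
    by have [/(_ u v Psi_u vp)[] ] := h s' n.
  - move=> r' s' n u v Psi_u vp; have [_ _ h] := hN r'.
    by have [/(_ u v Psi_u vp)[] ] := h s' n.
  - move=> r' s' n u v Psi_u vp; have [_ _ h] := hN r'.
    by have [/(_ u v Psi_u vp)[] ] := h s' n.
  - move=> r' n t m' Nnt; have [_ _ h] := hN r'.
    (* Condition (b) does not involve s, so it is read off at s = 0. *)
    have [_ /(_ n t Nnt)[z _ <-]] := h 0%N m'.
    exists (phi z) => //.
    by rewrite !rmorphM !rmorphXn !rmorph_nat.
rewrite rmorph_sum; apply: eq_bigr => j _; rewrite /dwork_term.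
case: leqP => jK.
  rewrite rmorphB !rmorphM; congr (to_tfrac _ * _ - to_tfrac _ * _).
    by rewrite /Az subzn.
  by rewrite /Az subzn.
rewrite /Az !ext_zero_lt0 ?mul0r ?subrr ?rmorph0 //; nia.
Qed.
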